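(* Let $(L,\forall)$ be a UMTL-algebra. Then the following statements are equivalent: (1) $(L,\forall)$ is representable; (2) $\forall(x\rightarrow y)\vee(y\rightarrow x)=1$ for all $x,y\in L$; (3) for all $x,y\in L$, $x\vee y=1$ implies $x\vee \forall y=1$; (4) every minimal prime filter of $L$ is a U-filter of $(L,\forall)$.
   Context: An MTL-algebra is a structure $(L,\wedge,\vee,\odot,\rightarrow,0,1)$ such that $(L,\wedge,\vee,0,1)$ is a bounded lattice (with order $\le$), $(L,\odot,1)$ is a commutative monoid, $x\odot y\leq z$ iff $x\leq y\rightarrow z$, and $(x\rightarrow y)\vee(y\rightarrow x)=1$ for all $x,y,z\in L$. A UMTL-algebra (MTL-algebra with a universal quantifier) is a structure $(L,\forall)=(L,\wedge,\vee,\odot,\rightarrow,0,1,\forall)$ where $(L,\wedge,\vee,\odot,\rightarrow,0,1)$ is an MTL-algebra and $\forall:L\to L$ is a unary operation satisfying, for all $x,y\in L$: (U1) $\forall x\leq x$; (U2) $\forall((x\rightarrow \forall y)\rightarrow \forall y)=(\forall x\rightarrow \forall y)\rightarrow \forall y$; (U3) $\forall(\forall x\rightarrow y)=\forall x\rightarrow\forall y$. A filter of $L$ is a nonempty subset $F\subseteq L$ with $1\in F$ and such that $x\in F$, $x\rightarrow y\in F$ imply $y\in F$; it is proper if $F\neq L$. A proper filter $F$ is prime if $x\vee y\in F$ implies $x\in F$ or $y\in F$; a prime filter is minimal if it is minimal with respect to inclusion among the prime filters of $L$. A filter $F$ of $L$ is a U-filter of $(L,\forall)$ if $x\in F$ implies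 $\forall x\in F$. A UMTL-algebra is representable if it is (isomorphic to) a subdirect product of a system of linearly ordered UMTL-algebras. *)

(* Defs.v *)
From HB Require Import structures.
From mathcomp Require Import all_boot all_order.
From mathcomp Require Import boolp classical_sets.

Set Implicit Arguments.
Unset Strict Implicit.
Unset Printing Implicit Defensive.

Import Order.TTheory.
Local Open Scope order_scope.

(* The one-element algebra (0 = 1) is allowed. *)
HB.mixin Record TBLattice_isMTL d L of Order.TBLattice d L := {
  mtl_mul : L -> L -> L;
  mtl_imp : L -> L -> L;
  mtl_mulA : associative mtl_mul;
  mtl_mulC : commutative mtl_mul;
  mtl_mul1x : left_id \top mtl_mul;
  mtl_residuation : forall x y z : L,
    (mtl_mul x y <= z) = (x <= mtl_imp y z);
  mtl_prelinearity : forall x y : L,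
    mtl_imp x y `|` mtl_imp y x = \top
}.

#[short(type="mtlType")]
HB.structure Definition MTL d := { L of TBLattice_isMTL d L & Order.TBLattice d L }.

Notation "x ⊙ y" := (mtl_mul x y) (at level 40, left associativity) : order_scope.
Notation "x ⇒ y" := (mtl_imp x y) (at level 55, right associativity) : order_scope.

HB.mixin Record MTL_isUMTL d L of MTL d L := {
  uq : L -> L;
  umtl_U1 : forall x : L, uq x <= x;
  umtl_U2 : forall x y : L, uq ((x ⇒ uq y) ⇒ uq y) = (uq x ⇒ uq y) ⇒ uq y;
  umtl_U3 : forall x y : L, uq (uq x ⇒ y) = uq x ⇒ uq y
}.

#[short(type="umtlType")]
HB.structure Definition UMTL d := { L of MTL_isUMTL d L & MTL d L }.

Section Filters.
Context {d : Order.disp_t}.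

Definition is_filter {L : mtlType d} (F : set L) : Prop :=
  F \top /\ forall x y : L, F x -> F (x ⇒ y) -> F y.

Definition proper_filter {L : mtlType d} (F : set L) : Prop :=
  is_filter F /\ F <> setT.

Definition prime_filter {L : mtlType d} (F : set L) : Prop :=
  proper_filter F /\ forall x y : L, F (x `|` y) -> F x \/ F y.

Definition minimal_prime_filter {L : mtlType d} (F : set L) : Prop :=
  prime_filter F /\
  forall G : set L, prime_filter G -> (G `<=` F)%classic -> G = F.

Definition is_U_filter {L : umtlType d} (F : set L) : Prop :=
  is_filter F /\ forall x : L, F x -> F (uq x).

End Filters.

(* Direct product of an arbitrary (possibly empty) family, with pointwise
   order and operations; the alias keeps these instances apart from the ones
   that bare function types already carry. *)
Definition umtl_prod d (I : Type) (A : I -> umtlType d) : Type :=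
  forall i, A i.

Section DirectProduct.
Variables (d : Order.disp_t) (I : Type) (A : I -> umtlType d).
Local Notation P := (umtl_prod A).
Implicit Types f g h : P.

HB.instance Definition _ := gen_eqMixin P.
HB.instance Definition _ := gen_choiceMixin P.

Definition prod_le f g : bool := `[< forall i, f i <= g i >].
Definition prod_lt f g : bool := (g != f) && prod_le f g.
Definition prod_meet f g : P := fun i => f i `&` g i.
Definition prod_join f g : P := fun i => f i `|` g i.
Definition prod_bot : P := fun=> \bot.
Definition prod_top : P := fun=> \top.
Definition prod_mul f g : P := fun i => f i ⊙ g i.
Definition prod_imp f g : P := fun i => f i ⇒ g i.
Definition prod_uq f : P := fun i => uq (f i).

Lemma umtl_prod_ext f g : (forall i, f i = g i) -> f = g.
Proof. by move=> fg; apply: functional_extensionality_dep. Qed.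

Fact prod_lt_def f g : prod_lt f g = (g != f) && prod_le f g.
Proof. by []. Qed.

Fact prod_le_refl : reflexive prod_le.
Proof. by move=> f; apply/asboolP. Qed.

Fact prod_le_anti : antisymmetric prod_le.
Proof.
move=> f g /andP[/asboolP fg /asboolP gf].
by apply: umtl_prod_ext => i; apply/eqP; rewrite eq_le fg gf.
Qed.

Fact prod_le_trans : transitive prod_le.
Proof.
move=> g f h /asboolP fg /asboolP gh; apply/asboolP => i.
exact: le_trans (fg i) (gh i).
Qed.

HB.instance Definition _ := Order.isPOrder.Build d P
  prod_lt_def prod_le_refl prod_le_anti prod_le_trans.

Lemma umtl_prod_leP f g : reflect (forall i, f i <= g i) (f <= g).
Proof. exact: asboolP. Qed.

Fact prod_lexI f g h : (f <= prod_meet g h) = (f <= g) && (f <= h).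
Proof.
apply/umtl_prod_leP/andP => [fgh | [/umtl_prod_leP fg /umtl_prod_leP fh] i].
  by split; apply/umtl_prod_leP => i; have := fgh i; rewrite lexI => /andP[].
by rewrite lexI fg fh.
Qed.

Fact prod_leUx f g h : (prod_join f g <= h) = (f <= h) && (g <= h).
Proof.
apply/umtl_prod_leP/andP => [fgh | [/umtl_prod_leP fh /umtl_prod_leP gh] i].
  by split; apply/umtl_prod_leP => i; have := fgh i; rewrite leUx => /andP[].
by rewrite leUx fh gh.
Qed.

HB.instance Definition _ :=
  Order.POrder_MeetJoin_isLattice.Build d P prod_lexI prod_leUx.

Fact prod_le0x f : prod_bot <= f.
Proof. by apply/umtl_prod_leP => i; exact: le0x. Qed.

Fact prod_lex1 f : f <= prod_top.
Proof. by apply/umtl_prod_leP => i; exact: lex1. Qed.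

HB.instance Definition _ := Order.hasBottom.Build d P prod_le0x.
HB.instance Definition _ := Order.hasTop.Build d P prod_lex1.

Fact prod_mulA : associative prod_mul.
Proof. by move=> f g h; apply: umtl_prod_ext => i; exact: mtl_mulA. Qed.

Fact prod_mulC : commutative prod_mul.
Proof. by move=> f g; apply: umtl_prod_ext => i; exact: mtl_mulC. Qed.

Fact prod_mul1x : left_id (\top : P) prod_mul.
Proof. by move=> f; apply: umtl_prod_ext => i; exact: mtl_mul1x. Qed.

Fact prod_residuation f g h : (prod_mul f g <= h) = (f <= prod_imp g h).
Proof.
apply/umtl_prod_leP/umtl_prod_leP => fgh i.
  by rewrite -mtl_residuation; exact: fgh.
by rewrite mtl_residuation; exact: fgh.
Qed.

Fact prod_prelinearity f g : prod_imp f g `|` prod_imp g f = \top.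
Proof. by apply: umtl_prod_ext => i; exact: mtl_prelinearity. Qed.

HB.instance Definition _ := TBLattice_isMTL.Build d P
  prod_mulA prod_mulC prod_mul1x prod_residuation prod_prelinearity.

Fact prod_U1 f : prod_uq f <= f.
Proof. by apply/umtl_prod_leP => i; exact: umtl_U1. Qed.

Fact prod_U2 f g :
  prod_uq ((f ⇒ prod_uq g) ⇒ prod_uq g) = (prod_uq f ⇒ prod_uq g) ⇒ prod_uq g.
Proof. by apply: umtl_prod_ext => i; exact: umtl_U2. Qed.

Fact prod_U3 f g : prod_uq (prod_uq f ⇒ g) = prod_uq f ⇒ prod_uq g.
Proof. by apply: umtl_prod_ext => i; exact: umtl_U3. Qed.

HB.instance Definition _ := MTL_isUMTL.Build d P prod_U1 prod_U2 prod_U3.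

End DirectProduct.

Section Representable.
Context {d : Order.disp_t}.

Record umtl_hom {L M : umtlType d} (f : L -> M) : Prop := UMTLHom {
  umtl_homI : {morph f : x y / x `&` y};
  umtl_homU : {morph f : x y / x `|` y};
  umtl_hom_mul : {morph f : x y / x ⊙ y};
  umtl_hom_imp : {morph f : x y / x ⇒ y};
  umtl_hom0 : f \bot = \bot;
  umtl_hom1 : f \top = \top;
  umtl_hom_uq : {morph f : x / uq x}
}.

Record subalgebra {L : umtlType d} (S : set L) : Prop := Subalgebra {
  subalgI : forall x y, S x -> S y -> S (x `&` y);
  subalgU : forall x y, S x -> S y -> S (x `|` y);
  subalg_mul : forall x y, S x -> S y -> S (x ⊙ y);
  subalg_imp : forall x y, S x -> S y -> S (x ⇒ y);
  subalg0 : S \bot;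
  subalg1 : S \top;
  subalg_uq : forall x, S x -> S (uq x)
}.

Definition subdirect_product (I : Type) (A : I -> umtlType d)
    (S : set (umtl_prod A)) : Prop :=
  subalgebra S /\ forall (i : I) (a : A i), exists2 f : umtl_prod A, S f & f i = a.

Definition linearly_ordered (L : umtlType d) : Prop :=
  total (<=%O : rel L).

(* The isomorphism with a subdirect product S is an injective homomorphism into
   the direct product whose image is S. *)
Definition representable (L : umtlType d) : Prop :=
  exists (I : Type) (A : I -> umtlType d) (S : set (umtl_prod A))
         (f : L -> umtl_prod A),
    [/\ forall i, linearly_ordered (A i),
        subdirect_product S,
        umtl_hom f,
        injective f &
        range f = S].

End Representable.

(* Main.v *)
From HB Require Import structures.
Require Import Defs.
From mathcomp Require Import all_boot all_order.
From mathcomp Require Import boolp classical_sets.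

(** In a linearly ordered UMTL-algebra one of [x ⇒ y], [y ⇒ x] is [\top], and
    [uq \top = \top], so [uq (x ⇒ y) `|` (y ⇒ x) = \top] holds there; being an
    identity, it passes to subalgebras of products.  When [x `|` y = \top] one
    has [x ⇒ y = y] and [y ⇒ x = x] ([cotop_imp]), so this identity then reads
    [uq y `|` x = \top].

    The other two implications rest on a duality: minimal prime filters are
    exactly the complements of maximal proper lattice ideals.  The complement
    of a proper ideal [I] is always upward closed and prime in the lattice
    sense; when [I] is maximal, [x] lies outside [I] iff [i `|` x = \top] for
    some [i] in [I] ([maximal_ideal_cotop]), and from this description closure
    under modus ponens is a short computation ([join_top_mp]).  Conversely, a
    minimal prime filter [F] is the complement of any maximal ideal containing its
    complement.  Hence for each [y] in [F] there is [x] outside [F] with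
    [x `|` y = \top] ([minimal_prime_cotop]).  If joins equal to [\top] stay so
    when [y] is replaced by [uq y], then [x `|` uq y = \top] lies in [F], and
    primality puts [uq y] in [F].

    Finally, the quotient of [L] by a filter closed under [uq] is again a
    UMTL-algebra, and it is linearly ordered when the filter is prime.  The
    minimal prime filters meet in [\top] only: if [a <> \top], the complement
    of a maximal ideal containing [a] is one that avoids [a].  So, when all of
    them are closed under [uq], [L] embeds in the product of its quotients by
    minimal prime filters. *)

Set Implicit Arguments.
Unset Strict Implicit.
Unset Printing Implicit Defensive.

Import Order.TTheory.
Local Open Scope order_scope.

(** * Residuation *)

Section Residuation.
Context {d : Order.disp_t} {L : mtlType d}.
Implicit Types x y z u v : L.

Lemma imp_top x y : (x ⇒ y = \top) <-> x <= y.
Proof.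
split=> [xy1|xy].
  by rewrite -(mtl_mul1x x) mtl_residuation xy1.
by apply/eqP; rewrite -le1x -mtl_residuation mtl_mul1x.
Qed.

Lemma impxx x : x ⇒ x = \top.
Proof. exact/imp_top. Qed.

Lemma mul_imp_le x y : x ⊙ (x ⇒ y) <= y.
Proof. by rewrite mtl_mulC mtl_residuation. Qed.

Lemma mul_le2r x y z : x <= y -> x ⊙ z <= y ⊙ z.
Proof.
by move=> xy; rewrite mtl_residuation (le_trans xy) // -mtl_residuation.
Qed.

Lemma mul_le_r x y : x ⊙ y <= y.
Proof. by have := mul_le2r y (lex1 x); rewrite mtl_mul1x. Qed.

Lemma mul_le_l x y : x ⊙ y <= x.
Proof. by rewrite mtl_mulC mul_le_r. Qed.

Lemma mul_joinl x y z u : ((x `|` y) ⊙ z <= u) = (x ⊙ z <= u) && (y ⊙ z <= u).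
Proof. by rewrite !mtl_residuation leUx. Qed.

Lemma mul_joinr x y z u : (z ⊙ (x `|` y) <= u) = (z ⊙ x <= u) && (z ⊙ y <= u).
Proof. by rewrite ![z ⊙ _]mtl_mulC mul_joinl. Qed.

Lemma imp_le2l x y z : x <= y -> y ⇒ z <= x ⇒ z.
Proof.
move=> xy; rewrite -mtl_residuation mtl_mulC.
exact: le_trans (mul_le2r _ xy) (mul_imp_le _ _).
Qed.

Lemma join_imp x y z : (x `|` y) ⇒ z = (x ⇒ z) `&` (y ⇒ z).
Proof.
apply/eqP; rewrite eq_le lexI !imp_le2l ?leUl ?leUr //=.
by rewrite -mtl_residuation mul_joinr !mtl_residuation leIl leIr.
Qed.

Lemma top_imp x : \top ⇒ x = x.
Proof.
apply/eqP; rewrite eq_le -mtl_residuation mtl_mulC mtl_mul1x lexx andbT.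
by have := mul_imp_le \top x; rewrite mtl_mul1x.
Qed.

(** Two elements whose join is [\top] absorb the implication between them,
    because [x `|` y] and [x] have the same implication into [y]. *)
Lemma cotop_imp x y : x `|` y = \top -> x ⇒ y = y.
Proof.
move=> xy1; have := join_imp x y y.
by rewrite xy1 top_imp impxx meetx1.
Qed.

(** Expanding the product of the two joins, every term other than
    [u ⊙ (u ⇒ v)] lies below [i] or [j]. *)
Lemma join_top_mp u v i j :
  i `|` u = \top -> j `|` (u ⇒ v) = \top -> (i `|` j) `|` v = \top.
Proof.
move=> iu juv; apply/eqP; rewrite -le1x -[\top](mtl_mul1x \top).
rewrite -{1}iu -{1}juv mul_joinl !mul_joinr -!andbA; apply/and4P; split.
- by apply: le_trans (mul_le_l _ _) _; rewrite -joinA leUl.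
- by apply: le_trans (mul_le_l _ _) _; rewrite -joinA leUl.
- by apply: le_trans (mul_le_r _ _) _; rewrite joinAC leUr.
- exact: le_trans (mul_imp_le u v) (leUr _ _).
Qed.

End Residuation.

Section Quantifier.
Context {d : Order.disp_t} {L : umtlType d}.
Implicit Types x y : L.

Lemma uq_top : uq (\top : L) = \top.
Proof.
have := umtl_U3 (\top : L) \top.
by rewrite impxx (iffRL (imp_top _ _) (lex1 _)).
Qed.

Lemma uq_le x y : x <= y -> uq x <= uq y.
Proof.
move=> xy; apply/imp_top; rewrite -umtl_U3.
by rewrite (iffRL (imp_top _ _) (le_trans (umtl_U1 x) xy)) uq_top.
Qed.

(** Monotonicity turns [uq x <= x] into [uq (x ⇒ y) <= uq (uq x ⇒ y)], where
    [umtl_U3] applies.  This makes a filter closed under [uq] a congruence for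
    [uq] as well. *)
Lemma uq_imp x y : uq (x ⇒ y) <= uq x ⇒ uq y.
Proof. by rewrite -umtl_U3; apply/uq_le/imp_le2l/umtl_U1. Qed.

End Quantifier.

(** * Maximal lattice ideals *)

Section Ideals.
Context {d : Order.disp_t} {L : tbLatticeType d}.
Implicit Types (I J : set L) (x y : L).
Local Open Scope classical_set_scope.

Record proper_ideal I : Prop := ProperIdeal {
  ideal_bot : I \bot;
  ideal_le : forall x y, x <= y -> I y -> I x;
  ideal_join : forall x y, I x -> I y -> I (x `|` y)%O;
  ideal_top : ~ I \top
}.

Definition maximal_ideal I : Prop :=
  proper_ideal I /\ forall J, proper_ideal J -> I `<=` J -> J = I.

(** Zorn's lemma is applied to unions of arbitrary chains, the empty one
    included; the sets considered are therefore allowed to be empty, and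
    otherwise required to contain the given ideal. *)
Lemma maximal_ideal_above I :
  proper_ideal I -> exists2 M, maximal_ideal M & I `<=` M.
Proof.
move=> idI.
pose P (X : set L) := [/\ forall x, X x -> I `<=` X,
  forall x y, x <= y -> X y -> X x,
  forall x y, X x -> X y -> X (x `|` y)%O & ~ X \top].
have [C CP Ctot|A [[PI Ple Pjoin Ptop] Amax]] := @Zorn_bigcup L P.
  split.
  - move=> x [X CX Xx] y Iy; exists X => //.
    by have [XI _ _ _] := CP _ CX; apply: XI Xx _ Iy.
  - move=> x y xy [X CX Xy]; exists X => //.
    by have [_ Xle _ _] := CP _ CX; apply: Xle xy Xy.
  - move=> x y [X CX Xx] [Y CY Yy].
    have [XY|YX] := Ctot _ _ CX CY.
      by exists Y => //; have [_ _ + _] := CP _ CY; apply=> //; apply: XY.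
    by exists X => //; have [_ _ + _] := CP _ CX; apply=> //; apply: YX.
  - by move=> [X CX]; have [] := CP _ CX.
have Pext J : proper_ideal J -> I `<=` J -> P J.
  by case=> _ Jle Jjoin Jtop IJ; split.
have IA : I `<=` A.
  have [[x Ax]|A0] := pselect (exists x, A x); first exact: PI Ax.
  case: (Amax I); last exact: Pext.
  split=> [x Ax|IA]; first by case: A0; exists x.
  by apply: A0; exists \bot; apply: IA; exact: ideal_bot.
exists A => //; split=> [|J idJ AJ].
  by split=> //; apply: IA; exact: ideal_bot.
apply/seteqP; split=> //; apply: contrapT => JA.
by apply: (Amax J); [split | apply: Pext => // x /IA /AJ].
Qed.

(** Otherwise the ideal generated by [I] and [x] would still be proper. *)
Lemma maximal_ideal_cotop I x :
  maximal_ideal I -> ~ I x -> exists2 i, I i & (i `|` x = \top)%O.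
Proof.
move=> [[I0 Ile Ijoin I1] Imax] Ix; apply: contrapT => notop.
pose J := [set z | exists2 i, I i & (z <= i `|` x)%O].
suff idJ : proper_ideal J.
  apply: Ix; rewrite -(Imax J idJ); first by exists \bot => //; exact: leUr.
  by move=> i Ii; exists i => //; exact: leUl.
split.
- by exists \bot => //; exact: le0x.
- by move=> y z yz [i Ii zi]; exists i => //; exact: le_trans zi.
- move=> y z [i Ii yi] [j Ij zj]; exists (i `|` j)%O; first exact: Ijoin.
  rewrite leUx (le_trans yi) ?(le_trans zj) //.
    by rewrite -joinA leUr.
  by rewrite joinAC leUl.
- by move=> [i Ii]; rewrite le1x => /eqP ix; apply: notop; exists i.
Qed.

Lemma principal_ideal a : a <> \top -> proper_ideal [set z | z <= a].
Proof.
move=> a1; split=> /=.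
- exact: le0x.
- by move=> x y; exact: le_trans.
- by move=> x y xa ya; rewrite leUx xa.
- by rewrite le1x => /eqP.
Qed.

End Ideals.

(** * Minimal prime filters *)

Section Filters.
Context {d : Order.disp_t} {L : mtlType d}.
Implicit Types (F G I : set L) (x y : L).
Local Open Scope classical_set_scope.

Lemma filter_up F x y : is_filter F -> x <= y -> F x -> F y.
Proof.
by move=> [F1 Fmp] xy Fx; apply: Fmp Fx _; rewrite (iffRL (imp_top _ _) xy).
Qed.

Lemma filter_mul F x y : is_filter F -> F x -> F y -> F (x ⊙ y).
Proof.
move=> fF Fx Fy; have [_ Fmp] := fF; apply: Fmp Fy _.
by apply: filter_up Fx => //; rewrite -mtl_residuation.
Qed.

Lemma prime_filter_ideal F : prime_filter F -> proper_ideal (~` F).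
Proof.
move=> [[fF FT] Fprime]; split.
- move=> F0; apply: FT; apply/seteqP; split=> // x _.
  by apply: filter_up F0 => //; exact: le0x.
- by move=> x y xy Fy Fx; apply: Fy; exact: filter_up Fx.
- by move=> x y Fx Fy /Fprime[].
- by apply; case: fF.
Qed.

(** Closure under modus ponens uses that being outside [I] means being joined
    to [\top] by an element of [I].  A prime filter inside the complement has as
    complement a proper ideal containing [I]. *)
Lemma maximal_ideal_minimal_prime I :
  maximal_ideal I -> minimal_prime_filter (~` I).
Proof.
move=> maxI; have [[I0 Ile Ijoin I1] Imax] := maxI.
split=> [|G pG GI].
  split; last first.
    move=> x y Ixy; apply: contrapT => /not_orP[/contrapT Ix /contrapT Iy].
    by apply: Ixy; exact: Ijoin.
  split; last by move=> IT; suff : (~` I) \bot by []; rewrite IT.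
  split=> // x y Ix Ixy Iy.
  have [i Ii ix] := maximal_ideal_cotop maxI Ix.
  have [j Ij jxy] := maximal_ideal_cotop maxI Ixy.
  apply: I1; rewrite -(join_top_mp ix jxy).
  exact: (Ijoin _ _ (Ijoin _ _ Ii Ij)) Iy.
rewrite -(Imax (~` G)) ?setCK //; first exact: prime_filter_ideal.
by rewrite -(setCK I); apply: subsetC.
Qed.

(** The complement of a maximal ideal above the complement of [F] is a prime
    filter inside [F], hence [F] itself. *)
Lemma minimal_prime_maximal_ideal F :
  minimal_prime_filter F -> maximal_ideal (~` F).
Proof.
move=> [pF Fmin].
have [M maxM FM] := maximal_ideal_above (prime_filter_ideal pF).
have <- : ~` M = F.
  apply: Fmin; first by case: (maximal_ideal_minimal_prime maxM).
  by rewrite -(setCK F); apply: subsetC.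
by rewrite setCK.
Qed.

Lemma minimal_prime_cotop F y :
  minimal_prime_filter F -> F y -> exists2 x, ~ F x & (x `|` y)%O = \top.
Proof.
move=> /minimal_prime_maximal_ideal maxF Fy.
by apply: maximal_ideal_cotop => //; apply.
Qed.

Lemma minimal_prime_avoiding (a : L) :
  a <> \top -> exists2 F, minimal_prime_filter F & ~ F a.
Proof.
move=> a1; have [M maxM aM] := maximal_ideal_above (principal_ideal a1).
exists (~` M); first exact: maximal_ideal_minimal_prime.
by apply; apply: aM => /=.
Qed.

End Filters.

(** * Quotient by a filter closed under the quantifier *)

Section FilterPreorder.
Context {d : Order.disp_t} {L : mtlType d}.
Variables (F : set L) (fF : is_filter F).
Implicit Types x y z : L.

(** The order of the quotient, pulled back to [L].  It is residuated like the
    order of [L], and the congruence properties of the lattice and monoid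
    operations follow from the adjunctions that characterize them. *)
Definition le_mod x y : Prop := F (x ⇒ y).
Local Notation "x ≼ y" := (le_mod x y) (at level 70).

Lemma le_mod_le x y : x <= y -> x ≼ y.
Proof.
by move=> xy; rewrite /le_mod (iffRL (imp_top _ _) xy); case: fF.
Qed.

Lemma le_mod_refl x : x ≼ x.
Proof. exact: le_mod_le. Qed.

Lemma le_mod_trans y x z : x ≼ y -> y ≼ z -> x ≼ z.
Proof.
move=> xy yz; apply: filter_up (filter_mul fF xy yz) => //.
rewrite -mtl_residuation mtl_mulC mtl_mulA.
exact: le_trans (mul_le2r _ (mul_imp_le _ _)) (mul_imp_le _ _).
Qed.

Lemma le_mod_meet x y z : x ≼ (y `&` z) <-> x ≼ y /\ x ≼ z.
Proof.
split=> [xyz|[xy xz]].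
  by split; apply: (le_mod_trans xyz); apply: le_mod_le; rewrite ?leIl ?leIr.
apply: filter_up (filter_mul fF xy xz) => //.
by rewrite -mtl_residuation lexI ![_ ⊙ x <= _]mtl_residuation mul_le_l mul_le_r.
Qed.

Lemma le_mod_join x y z : (x `|` y) ≼ z <-> x ≼ z /\ y ≼ z.
Proof.
split=> [xyz|[xz yz]].
  by split; apply: le_mod_trans xyz; apply: le_mod_le; rewrite ?leUl ?leUr.
apply: filter_up (filter_mul fF xz yz) => //.
by rewrite join_imp lexI mul_le_l mul_le_r.
Qed.

Lemma le_mod_residuation x y z : (x ⊙ y) ≼ z <-> x ≼ (y ⇒ z).
Proof.
suff xyz : x ⊙ y ⇒ z = x ⇒ (y ⇒ z) by rewrite /le_mod xyz.
apply/eqP; rewrite eq_le; apply/andP; split.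
  by rewrite -2!mtl_residuation -mtl_mulA mtl_residuation.
by rewrite -mtl_residuation mtl_mulA !mtl_residuation.
Qed.

Lemma le_mod_mul2 x x' y y' : x ≼ x' -> y ≼ y' -> (x ⊙ y) ≼ (x' ⊙ y').
Proof.
have mul2r u v z : u ≼ v -> (u ⊙ z) ≼ (v ⊙ z).
  move=> uv; apply/le_mod_residuation; apply: le_mod_trans uv _.
  exact/le_mod_residuation/le_mod_refl.
move=> xx' yy'; apply: le_mod_trans (mul2r _ _ y xx') _.
by rewrite ![x' ⊙ _]mtl_mulC; exact: mul2r.
Qed.

Lemma le_mod_imp2 x x' y y' : x' ≼ x -> y ≼ y' -> (x ⇒ y) ≼ (x' ⇒ y').
Proof.
move=> xx' yy'; apply/le_mod_residuation; apply: le_mod_trans yy'.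
apply: le_mod_trans (le_mod_mul2 (le_mod_refl _) xx') _.
exact/le_mod_residuation/le_mod_refl.
Qed.

Lemma le_mod_meet2 x x' y y' : x ≼ x' -> y ≼ y' -> (x `&` y) ≼ (x' `&` y').
Proof.
move=> xx' yy'; apply/le_mod_meet; split.
  by apply: le_mod_trans xx'; apply: le_mod_le; exact: leIl.
by apply: le_mod_trans yy'; apply: le_mod_le; exact: leIr.
Qed.

Lemma le_mod_join2 x x' y y' : x ≼ x' -> y ≼ y' -> (x `|` y) ≼ (x' `|` y').
Proof.
move=> xx' yy'; apply/le_mod_join; split.
  by apply: le_mod_trans xx' _; apply: le_mod_le; exact: leUl.
by apply: le_mod_trans yy' _; apply: le_mod_le; exact: leUr.
Qed.

End FilterPreorder.

Section Quotient.
Context {d : Order.disp_t} {L : umtlType d}.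
Variables (F : set L) (uF : is_U_filter F).
Implicit Types x y z : L.

Let fF : is_filter F := proj1 uF.
Local Notation "x ≼ y" := (le_mod F x y) (at level 70).

Lemma le_mod_uq x y : x ≼ y -> uq x ≼ uq y.
Proof. by move=> /(proj2 uF) Fxy; exact: filter_up (uq_imp x y) Fxy. Qed.

Definition eq_mod x y : bool := `[< x ≼ y /\ y ≼ x >].

Fact eq_mod_refl : reflexive eq_mod.
Proof. by move=> x; apply/asboolP; split; exact: le_mod_refl. Qed.

Fact eq_mod_sym : symmetric eq_mod.
Proof. by move=> x y; apply/asboolP/asboolP => -[]. Qed.

Fact eq_mod_trans : transitive eq_mod.
Proof.
move=> y x z /asboolP[xy yx] /asboolP[yz zy].
by apply/asboolP; split; apply: (@le_mod_trans _ _ _ fF y).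
Qed.

Definition eq_mod_equiv : equiv_rel L :=
  EquivRel eq_mod eq_mod_refl eq_mod_sym eq_mod_trans.

Definition filter_quot : Type := {eq_quot eq_mod_equiv}%qT.
Local Notation Q := filter_quot.

HB.instance Definition _ := Choice.on Q.
HB.instance Definition _ := Quotient.on Q.

Definition proj x : Q := \pi_Q%qT x.
Local Notation "⟦ x ⟧" := (proj x) (at level 0).

Lemma proj_surj (u : Q) : exists x, u = ⟦x⟧.
Proof. by exists (repr u); rewrite /proj reprK. Qed.

Lemma proj_eq x y : ⟦x⟧ = ⟦y⟧ <-> x ≼ y /\ y ≼ x.
Proof.
split=> [/(@eqmodP _ _ _ _)/asboolP//|xy].
by apply/eqmodP/asboolP.
Qed.

Lemma repr_proj x : repr ⟦x⟧ ≼ x /\ x ≼ repr ⟦x⟧.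
Proof. by apply/proj_eq; rewrite /proj reprK. Qed.

Implicit Types u v w : Q.

Definition quot_le u v : bool := `[< repr u ≼ repr v >].
Definition quot_lt u v : bool := (v != u) && quot_le u v.
Definition quot_meet u v : Q := ⟦repr u `&` repr v⟧.
Definition quot_join u v : Q := ⟦repr u `|` repr v⟧.
Definition quot_mul u v : Q := ⟦repr u ⊙ repr v⟧.
Definition quot_imp u v : Q := ⟦repr u ⇒ repr v⟧.
Definition quot_uq u : Q := ⟦uq (repr u)⟧.

Lemma quot_leE x y : quot_le ⟦x⟧ ⟦y⟧ <-> x ≼ y.
Proof.
have [rx xr] := repr_proj x; have [ry yr] := repr_proj y.
split=> [/asboolP xy|xy]; last apply/asboolP.
  by apply: le_mod_trans xr (le_mod_trans _ xy ry).
by apply: le_mod_trans rx (le_mod_trans _ xy yr).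
Qed.


Lemma quot_meetE x y : quot_meet ⟦x⟧ ⟦y⟧ = ⟦x `&` y⟧.
Proof.
have [rx xr] := repr_proj x; have [ry yr] := repr_proj y.
by apply/proj_eq; split; exact: le_mod_meet2.
Qed.

Lemma quot_joinE x y : quot_join ⟦x⟧ ⟦y⟧ = ⟦x `|` y⟧.
Proof.
have [rx xr] := repr_proj x; have [ry yr] := repr_proj y.
by apply/proj_eq; split; exact: le_mod_join2.
Qed.

Lemma quot_mulE x y : quot_mul ⟦x⟧ ⟦y⟧ = ⟦x ⊙ y⟧.
Proof.
have [rx xr] := repr_proj x; have [ry yr] := repr_proj y.
by apply/proj_eq; split; exact: le_mod_mul2.
Qed.

Lemma quot_impE x y : quot_imp ⟦x⟧ ⟦y⟧ = ⟦x ⇒ y⟧.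
Proof.
have [rx xr] := repr_proj x; have [ry yr] := repr_proj y.
by apply/proj_eq; split; exact: le_mod_imp2.
Qed.

Lemma quot_uqE x : quot_uq ⟦x⟧ = ⟦uq x⟧.
Proof.
by have [rx xr] := repr_proj x; apply/proj_eq; split; exact: le_mod_uq.
Qed.

Fact quot_lt_def u v : quot_lt u v = (v != u) && quot_le u v.
Proof. by []. Qed.

Fact quot_le_refl : reflexive quot_le.
Proof. by move=> u; apply/asboolP; exact: le_mod_refl. Qed.

Fact quot_le_anti : antisymmetric quot_le.
Proof.
move=> u v; have [x ->] := proj_surj u; have [y ->] := proj_surj v.
by move=> /andP[/quot_leE xy /quot_leE yx]; exact/proj_eq.
Qed.

Fact quot_le_trans : transitive quot_le.
Proof.
move=> v u w /asboolP uv /asboolP vw.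
by apply/asboolP; exact: le_mod_trans uv vw.
Qed.

HB.instance Definition _ := Order.isPOrder.Build d Q
  quot_lt_def quot_le_refl quot_le_anti quot_le_trans.

Lemma proj_leP x y : ⟦x⟧ <= ⟦y⟧ <-> x ≼ y.
Proof. exact: quot_leE. Qed.

Fact quot_lexI u v w : (u <= quot_meet v w) = (u <= v) && (u <= w).
Proof.
have [x ->] := proj_surj u; have [y ->] := proj_surj v.
have [z ->] := proj_surj w; rewrite quot_meetE.
apply/idP/andP.
  move=> /proj_leP/(le_mod_meet fF)[xy xz].
  by split; exact/proj_leP.
by move=> [/proj_leP xy /proj_leP xz]; apply/proj_leP/(le_mod_meet fF).
Qed.

Fact quot_leUx u v w : (quot_join u v <= w) = (u <= w) && (v <= w).
Proof.
have [x ->] := proj_surj u; have [y ->] := proj_surj v.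
have [z ->] := proj_surj w; rewrite quot_joinE.
apply/idP/andP.
  move=> /proj_leP/(le_mod_join fF)[xz yz].
  by split; exact/proj_leP.
by move=> [/proj_leP xz /proj_leP yz]; apply/proj_leP/(le_mod_join fF).
Qed.

HB.instance Definition _ :=
  Order.POrder_MeetJoin_isLattice.Build d Q quot_lexI quot_leUx.

Fact quot_le0x u : ⟦\bot⟧ <= u.
Proof.
by have [x ->] := proj_surj u; apply/proj_leP/(le_mod_le fF); exact: le0x.
Qed.

Fact quot_lex1 u : u <= ⟦\top⟧.
Proof.
by have [x ->] := proj_surj u; apply/proj_leP/(le_mod_le fF); exact: lex1.
Qed.

HB.instance Definition _ := Order.hasBottom.Build d Q quot_le0x.
HB.instance Definition _ := Order.hasTop.Build d Q quot_lex1.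

Fact quot_mulA : associative quot_mul.
Proof.
move=> u v w; have [x ->] := proj_surj u; have [y ->] := proj_surj v.
by have [z ->] := proj_surj w; rewrite !quot_mulE mtl_mulA.
Qed.

Fact quot_mulC : commutative quot_mul.
Proof. by move=> u v; rewrite /quot_mul mtl_mulC. Qed.

Fact quot_mul1x : left_id (\top : Q) quot_mul.
Proof.
move=> u; have [x ->] := proj_surj u.
by rewrite [\top]/(⟦\top⟧) quot_mulE mtl_mul1x.
Qed.

Fact quot_residuation u v w : (quot_mul u v <= w) = (u <= quot_imp v w).
Proof.
have [x ->] := proj_surj u; have [y ->] := proj_surj v.
have [z ->] := proj_surj w; rewrite quot_mulE quot_impE.
by apply/idP/idP => /proj_leP h; apply/proj_leP/le_mod_residuation.
Qed.

Fact quot_prelinearity u v : quot_imp u v `|` quot_imp v u = \top.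
Proof.
have [x ->] := proj_surj u; have [y ->] := proj_surj v.
by rewrite !quot_impE [LHS]quot_joinE mtl_prelinearity.
Qed.

HB.instance Definition _ := TBLattice_isMTL.Build d Q
  quot_mulA quot_mulC quot_mul1x quot_residuation quot_prelinearity.

Fact quot_U1 u : quot_uq u <= u.
Proof.
have [x ->] := proj_surj u; rewrite quot_uqE.
by apply/proj_leP/(le_mod_le fF); exact: umtl_U1.
Qed.

Fact quot_U2 u v :
  quot_uq ((u ⇒ quot_uq v) ⇒ quot_uq v) = (quot_uq u ⇒ quot_uq v) ⇒ quot_uq v.
Proof.
have [x ->] := proj_surj u; have [y ->] := proj_surj v.
by rewrite /mtl_imp /= !(quot_uqE, quot_impE) umtl_U2.
Qed.

Fact quot_U3 u v : quot_uq (quot_uq u ⇒ v) = quot_uq u ⇒ quot_uq v.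
Proof.
have [x ->] := proj_surj u; have [y ->] := proj_surj v.
by rewrite /mtl_imp /= !(quot_uqE, quot_impE) umtl_U3.
Qed.

HB.instance Definition _ := MTL_isUMTL.Build d Q quot_U1 quot_U2 quot_U3.

Lemma proj_hom : umtl_hom proj.
Proof.
split=> //.
- by move=> x y; rewrite -quot_meetE.
- by move=> x y; rewrite -quot_joinE.
- by move=> x y; rewrite -quot_mulE.
- by move=> x y; rewrite -quot_impE.
- by move=> x; rewrite -quot_uqE.
Qed.

Lemma quot_linear :
  (forall x y, F (x `|` y) -> F x \/ F y) -> linearly_ordered (Q : umtlType d).
Proof.
move=> Fprime u v; have [x ->] := proj_surj u; have [y ->] := proj_surj v.
have : F ((x ⇒ y) `|` (y ⇒ x)) by rewrite mtl_prelinearity; case: fF.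
by move=> /Fprime[] /proj_leP -> //; rewrite orbT.
Qed.

End Quotient.

(** * Representability *)

Section Representability.
Context {d : Order.disp_t}.
Implicit Types L M : umtlType d.

Lemma range_subalgebra L M (f : L -> M) : umtl_hom f -> subalgebra (range f).
Proof.
move=> [fI fU fmul fimp f0 f1 fuq]; split.
- by move=> _ _ [x _ <-] [y _ <-]; exists (x `&` y).
- by move=> _ _ [x _ <-] [y _ <-]; exists (x `|` y).
- by move=> _ _ [x _ <-] [y _ <-]; exists (x ⊙ y).
- by move=> _ _ [x _ <-] [y _ <-]; exists (x ⇒ y).
- by exists \bot.
- by exists \top.
- by move=> _ [x _ <-]; exists (uq x).
Qed.

Lemma tuple_hom L (I : Type) (A : I -> umtlType d) (f : forall i, L -> A i) :
  (forall i, umtl_hom (f i)) ->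
  umtl_hom (fun x => (fun i => f i x) : umtl_prod A).
Proof.
move=> fhom; split.
- by move=> x y; apply: umtl_prod_ext => i; exact: umtl_homI.
- by move=> x y; apply: umtl_prod_ext => i; exact: umtl_homU.
- by move=> x y; apply: umtl_prod_ext => i; exact: umtl_hom_mul.
- by move=> x y; apply: umtl_prod_ext => i; exact: umtl_hom_imp.
- by apply: umtl_prod_ext => i; exact: umtl_hom0.
- by apply: umtl_prod_ext => i; exact: umtl_hom1.
- by move=> x; apply: umtl_prod_ext => i; exact: umtl_hom_uq.
Qed.

(** One of the two implications is [\top] outright. *)
Lemma linear_uq_prelinear L (x y : L) :
  linearly_ordered L -> uq (x ⇒ y) `|` (y ⇒ x) = \top.
Proof.
move=> Ltot; case/orP: (Ltot x y) => [/imp_top|/imp_top] ->.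
  by rewrite uq_top join1x.
by rewrite joinx1.
Qed.

Lemma representable_uq_prelinear L :
  representable L -> forall x y : L, uq (x ⇒ y) `|` (y ⇒ x) = \top.
Proof.
move=> [I [A [S [f [Atot _ [_ fU _ fimp _ f1 fuq] finj _]]]]] x y.
apply: finj; rewrite fU fuq !fimp f1; apply: umtl_prod_ext => i.
exact: linear_uq_prelinear.
Qed.

Lemma uq_prelinear_cotop L :
  (forall x y : L, uq (x ⇒ y) `|` (y ⇒ x) = \top) ->
  forall x y : L, x `|` y = \top -> x `|` uq y = \top.
Proof.
move=> prelin x y xy; have := prelin x y.
by rewrite (cotop_imp xy) (@cotop_imp _ _ y x) 1?joinC.
Qed.

(** An element [x] outside [F] with [x `|` y = \top] transfers the membership
    of [y] to [uq y]. *)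
Lemma cotop_minimal_prime_U_filter L :
  (forall x y : L, x `|` y = \top -> x `|` uq y = \top) ->
  forall F : set L, minimal_prime_filter F -> is_U_filter F.
Proof.
move=> cotop F minF; have [[[fF _] Fprime] _] := minF.
split=> // y Fy; have [x Fx xy] := minimal_prime_cotop minF Fy.
have : F (x `|` uq y) by rewrite cotop //; case: fF.
by case/Fprime.
Qed.

(** Injectivity is where minimal primes are plentiful enough: if [x <= y] fails,
    some minimal prime filter avoids [x ⇒ y], and the classes of [x] and [y]
    in the quotient by it differ. *)
Lemma minimal_prime_U_filter_representable L :
  (forall F : set L, minimal_prime_filter F -> is_U_filter F) ->
  representable L.
Proof.
move=> minU.
pose I := {F : set L | minimal_prime_filter F}.
pose U (i : I) := minU (sval i) (svalP i).
pose A (i : I) : umtlType d := filter_quot (U i).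
pose f (x : L) : umtl_prod A := fun i => proj (U i) x.
have fhom : umtl_hom f by apply: tuple_hom => i; exact: proj_hom.
exists I, A, (range f), f; split=> //.
- by move=> i; apply: quot_linear; case: (svalP i) => -[].
- split=> [|i a]; first exact: range_subalgebra.
  by have [x ->] := proj_surj a; exists (f x).
suff fle x y : f x = f y -> x <= y.
  by move=> x y fxy; apply/eqP; rewrite eq_le !fle.
move=> fxy; apply/imp_top; apply: contrapT => xy.
have [F minF Fxy] := minimal_prime_avoiding xy.
have : f x (exist _ F minF) = f y (exist _ F minF) by rewrite fxy.
by case/proj_eq.
Qed.

End Representability.

Theorem theorem4p7 (d : Order.disp_t) (L : umtlType d) :
  [<-> representable L;
       forall x y : L, uq (x ⇒ y) `|` (y ⇒ x) = \top;
       forall x y : L, x `|` y = \top -> x `|` uq y = \top;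
       forall F : set L, minimal_prime_filter F -> is_U_filter F].
Proof.
tfae.
- exact: representable_uq_prelinear.
- exact: uq_prelinear_cotop.
- exact: cotop_minimal_prime_U_filter.
- exact: minimal_prime_U_filter_representable.
Qed.
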